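(* Let $\beta>1$, $m>0$, and let $X$ be a random variable with density $h_{\beta,m}(x)=C_{\beta,m}x^{-2\beta}e^{-m/x}$, $x\in(0,\infty)$. Let $\alpha$ satisfy $1<\alpha\le\frac32$ and $\alpha<\beta$. Then for every bounded smooth $\phi:(0,\infty)\to\mathbb R$ such that $\phi(X)$ has finite entropy, $$\mathrm{Ent}[\phi^2(X)]\le\frac{2}{\rho_{\beta,\alpha,m}}\,E\big\{X^{2\alpha}[\phi'(X)]^2\big\},$$ where $$\rho_{\beta,\alpha,m}=\begin{cases}\dfrac12\Big(\dfrac{2\beta-\alpha}{\frac32-\alpha}\Big)^{3-2\alpha}\big(m(2-\alpha)\big)^{2\alpha-2}(\alpha-1)^{5-4\alpha}, & 1<\alpha<\tfrac32,\\[2mm] \dfrac m2, & \alpha=\tfrac32\ (\text{so }\beta>\tfrac32).\end{cases}$$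
   Context: $C_{\beta,m}>0$ is the normalizing constant making $h_{\beta,m}$ a probability density on $(0,\infty)$. $\mathrm{Ent}[\phi^2(X)]=E[\phi^2(X)\log\phi^2(X)]-E[\phi^2(X)]\log E[\phi^2(X)]$. *)

(* Defs.v *)
From HB Require Import structures.
From mathcomp Require Import all_boot all_order all_algebra.
From mathcomp Require Import all_classical all_reals all_analysis.
Set Implicit Arguments. Unset Strict Implicit. Unset Printing Implicit Defensive.
Import Order.TTheory GRing.Theory Num.Theory.
Import numFieldNormedType.Exports.
Local Open Scope classical_set_scope.
Local Open Scope ring_scope.

Section Defs.
Variable R : realType.

Definition posR : set R := `]0, +oo[%classic.

Definition hraw (beta m : R) (x : R) : R := x `^ (-(2 * beta)) * expR (- (m / x)).

Definition Cbm (beta m : R) : R :=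
  (fine (\int[@lebesgue_measure R]_(x in posR) (hraw beta m x)%:E))^-1.

Definition hdens (beta m : R) (x : R) : R := Cbm beta m * hraw beta m x.

Definition Eh (beta m : R) (f : R -> R) : \bar R :=
  (\int[@lebesgue_measure R]_(x in posR) (f x * hdens beta m x)%:E)%E.

(* Ent[g(X)] = E[g log g] - E[g] log E[g]  (with the convention 0 log 0 = 0) *)
Definition Enth (beta m : R) (g : R -> R) : \bar R :=
  (Eh beta m (fun x => (g x * ln (g x))%R)
   - Eh beta m g * (ln (fine (Eh beta m g)))%:E)%E.

Definition finite_entropy (beta m : R) (phi : R -> R) : Prop :=
  (@lebesgue_measure R).-integrable posR
     (fun x => (phi x ^+ 2 * ln (phi x ^+ 2) * hdens beta m x)%:E).

Definition smooth_pos (phi : R -> R) : Prop :=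
  forall (n : nat) (x : R), 0 < x -> derivable (derive1n n phi) x 1.

Definition bounded_pos (phi : R -> R) : Prop :=
  exists M : R, forall x : R, 0 < x -> `|phi x| <= M.

Definition rho (beta alpha m : R) : R :=
  if alpha < 3 / 2 then
    2^-1 * ((2 * beta - alpha) / (3 / 2 - alpha)) `^ (3 - 2 * alpha)
      * (m * (2 - alpha)) `^ (2 * alpha - 2) * (alpha - 1) `^ (5 - 4 * alpha)
  else m / 2.

End Defs.

(* Main.v *)
(* Transport proof of the logarithmic Sobolev inequality.  In the coordinate
   u = x^(1 - alpha) / (alpha - 1) the Dirichlet form becomes E[(d phi / du)^2]
   and the law of X becomes c exp (- V(u)) du with
     V'' = (2 beta - alpha) (alpha - 1) x^(2 alpha - 2)
           + m (2 - alpha) x^(2 alpha - 3),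
   whose infimum over x is rho, by the weighted AM-GM inequality.  For a smooth
   positive density g with respect to the law of X, let T be the monotone map
   sending the law g h dx to h dx, and put D = u(T) - u, tau = d u(T) / du.  The
   Jacobian equation gives ln g = V(u) - V(u(T)) + ln tau; bounding ln tau by
   tau - 1 and using V'' >= rho,
     g ln g <= g (tau - 1 - D V') - rho / 2 D^2 g,
   and, by Young's inequality, up to (dg/du)^2 / (2 rho g) the right-hand side
   times the density is the derivative of the flux g D exp (- V).  The flux
   vanishes at infinity and along a sequence tending to 0, hence
     Ent g <= E[(dg/du)^2 / g] / (2 rho).
   This is applied to g = (phi^2 + e) / E[phi^2 + e], and e tends to 0. *)

Require Import Defs.
From HB Require Import structures.
From mathcomp Require Import all_boot all_order all_algebra.
From mathcomp Require Import all_classical all_reals all_analysis.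
From mathcomp Require Import measurable_realfun ring lra.
Import Order.TTheory GRing.Theory Num.Theory.
Import numFieldNormedType.Exports.
Local Open Scope classical_set_scope.
Local Open Scope ring_scope.
Set Implicit Arguments.
Unset Strict Implicit.
Unset Printing Implicit Defensive.

(** * Differentiation rules for pointwise expressions *)

Section derive1_rules.
Variables (R : realType) (x : R).
Implicit Types (f g : R -> R) (a b c : R).

(** The rules are stated for explicit [fun y => ...], so that derivatives of long expressions can be
    assembled as terms and their values adjusted afterwards by [is_derive_eq]. *)
Lemma is_derive1D f g a b : is_derive x 1 f a -> is_derive x 1 g b ->
  is_derive x 1 (fun y => f y + g y) (a + b).
Proof. by move=> df dg; exact: is_deriveD. Qed.

Lemma is_derive1N f a : is_derive x 1 f a ->
  is_derive x 1 (fun y => - f y) (- a).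
Proof. by move=> df; exact: is_deriveN. Qed.

Lemma is_derive1B f g a b : is_derive x 1 f a -> is_derive x 1 g b ->
  is_derive x 1 (fun y => f y - g y) (a - b).
Proof. by move=> df dg; exact: is_deriveB. Qed.

Lemma is_derive1M f g a b : is_derive x 1 f a -> is_derive x 1 g b ->
  is_derive x 1 (fun y => f y * g y) (a * g x + f x * b).
Proof.
move=> df dg; have := @is_deriveM R _ f g x 1 a b df dg.
by move/is_derive_eq; apply; rewrite /GRing.scale/=; ring.
Qed.

Lemma is_derive1Z c f a : is_derive x 1 f a ->
  is_derive x 1 (fun y => c * f y) (c * a).
Proof. by move=> df; exact: is_deriveZ. Qed.

Lemma is_derive1B_cst c f a : is_derive x 1 f a ->
  is_derive x 1 (fun y => f y - c) a.
Proof.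
move=> df; have := is_derive1B df (is_derive_cst c x 1).
by rewrite subr0.
Qed.

Lemma is_derive1V : x != 0 -> is_derive x 1 (fun y => y^-1) (- x ^- 2).
Proof.
move=> x0; have := @is_deriveV R id x 1 1 x0 (is_derive_id _ _).
by move/is_derive_eq; apply; rewrite /GRing.scale/= mulr1.
Qed.

Lemma is_derive1_continuous f a : is_derive x 1 f a -> {for x, continuous f}.
Proof.
by move=> [df _]; apply/differentiable_continuous/derivable1_diffP.
Qed.

End derive1_rules.

(** * Monotonicity from derivatives, and primitives on the half-line *)

Section primitives.
Variable R : realType.
Notation mu := (@lebesgue_measure R).

Lemma nondecreasing_of_is_derive (f df : R -> R) (a b : R) : a <= b ->
  (forall x, a <= x <= b -> is_derive x 1 f (df x)) ->
  (forall x, a <= x <= b -> 0 <= df x) -> f a <= f b.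
Proof.
move=> ab fdf df0.
have cf : {within `[a, b], continuous f}.
  apply: derivable_within_continuous => x; rewrite in_itv/= => xab.
  exact: (@ex_derive _ _ _ _ _ _ _ (fdf x xab)).
have [|c cab fE] := @MVT_segment R f df a b ab _ cf.
  move=> x; rewrite in_itv/= => /andP[ax xb].
  by apply: fdf; rewrite !ltW.
rewrite -subr_ge0 fE mulr_ge0 ?subr_ge0//.
by apply: df0; move: cab; rewrite in_itv.
Qed.

Lemma increasing_of_is_derive (f df : R -> R) (a b : R) : a < b ->
  (forall x, a <= x <= b -> is_derive x 1 f (df x)) ->
  (forall x, a <= x <= b -> 0 < df x) -> f a < f b.
Proof.
move=> ab fdf df0.
have cf : {within `[a, b], continuous f}.
  apply: derivable_within_continuous => x; rewrite in_itv/= => xab.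
  exact: (@ex_derive _ _ _ _ _ _ _ (fdf x xab)).
have [|c cab fE] := @MVT_segment R f df a b (ltW ab) _ cf.
  move=> x; rewrite in_itv/= => /andP[ax xb].
  by apply: fdf; rewrite !ltW.
rewrite -subr_gt0 fE mulr_gt0 ?subr_gt0//.
by apply: df0; move: cab; rewrite in_itv.
Qed.

Lemma posRE (x : R) : @posR R x <-> 0 < x.
Proof. by rewrite /posR/= in_itv/= andbT. Qed.

Lemma measurable_posR : measurable (@posR R).
Proof. exact: measurable_itv. Qed.

Lemma integral_posR_fin_num (f : R -> \bar R) :
  mu.-integrable (@posR R) f -> (\int[mu]_(x in @posR R) f x)%E \is a fin_num.
Proof. by apply: integrable_fin_num; exact: measurable_posR. Qed.

Lemma measurable_fun_posR (f : R -> R) :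
  (forall x, 0 < x -> {for x, continuous f}) -> measurable_fun (@posR R) f.
Proof.
move=> cf; apply: open_continuous_measurable_fun; first exact: interval_open.
by move=> x /set_mem/posRE; exact: cf.
Qed.

(** [L x] is the integral over [0, x] of [f] extended by 0 outside the half-line; it vanishes for x
    < 0, so the limit at 0 can be two-sided. The limit at infinity follows by dominated
    convergence. *)
Lemma improper_primitive (f : R -> R) :
  (forall x, 0 < x -> {for x, continuous f}) ->
  mu.-integrable (@posR R) (EFin \o f) ->
  exists L : R -> R, [/\ (forall x : R, 0 < x -> is_derive x 1 L (f x)),
    (L x @[x --> 0] --> (0 : R)) &
    (L n%:R @[n --> \oo] --> fine (\int[mu]_(x in @posR R) (f x)%:E)%E)].
Proof.
move=> cf intf.
pose f0 := f \_ (@posR R).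
have mpos := measurable_posR.
have intf0 : mu.-integrable setT (EFin \o f0).
  rewrite -restrict_EFin; apply/integrable_restrict => //.
  by rewrite setTI.
have intf0S A : measurable A -> mu.-integrable A (EFin \o f0).
  by move=> mA; exact: integrableS intf0.
pose L x := \int[mu]_(t in `[0, x]) f0 t.
exists L; split.
- move=> x x0.
  have cf0 : {for x, continuous f0}.
    have f0f : {near x, f =1 f0}.
      near=> y; rewrite /f0 patchE mem_set//; apply/posRE.
      by near: y; exact: lt_nbhsr.
    apply: cvg_trans; first exact: near_eq_cvg f0f.
    rewrite /f0 patchE mem_set; last exact/posRE.
    exact: cf.
  (* The endpoint [x + 1] only serves to make [x] interior to an interval on which the fundamental
     theorem applies. *)
  have xx1 : x < x + 1 by rewrite ltrDl.
  have [dL LE] := @continuous_FTC1_closed R f0 0 x (x + 1) xx1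
    (intf0S _ (measurable_itv _)) x0 cf0.
  apply: DeriveDef => //.
  rewrite -derive1E LE /f0 patchE mem_set//; exact/posRE.
- exact: (@parameterized_integral_cvg_left R 0 1 f0 ltr01
    (intf0S _ (measurable_itv _))).
(* Truncations to [0, n], dominated by |f0|. *)
- pose fn n := (EFin \o f0) \_ `[0, n%:R].
  have mf0 : measurable_fun setT (EFin \o f0) by exact: measurable_int intf0.
  have [|||||_ _ cvL] := @dominated_convergence _ _ _ mu setT measurableT fn
    (EFin \o f0) (abse \o (EFin \o f0)).
  + move=> n; apply/(measurable_restrictT _ _).1 => //.
    exact: measurable_funS mf0.
  + exact: mf0.
  + apply: aeW => x _; apply: cvg_near_cst.
    have [x0|x0] := ltP 0 x; last first.
      near=> n; rewrite /fn patchE; case: ifP => //= _.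
      by rewrite /f0 patchE memNset// => /posRE; rewrite ltNge x0.
    near=> n; rewrite /fn patchE mem_set//= in_itv/= ltW//=.
    by near: n; exact: nbhs_infty_ger.
  + exact: integrable_abse.
  + apply: aeW => x n _; rewrite /fn patchE; case: ifP => //= _.
    by rewrite normr0 lee_fin.
  have E1 n : (\int[mu]_x fn n x)%E = (L n%:R)%:E.
    rewrite -integral_mkcond /L /Rintegral fineK//.
    by apply: integrable_fin_num => //; exact: intf0S.
  have E2 : (\int[mu]_x (EFin \o f0) x)%E = (\int[mu]_(x in @posR R) (f x)%:E)%E.
    by rewrite [RHS]integral_mkcond -restrict_EFin.
  have fi := integral_posR_fin_num intf.
  move: cvL; rewrite E2 -[X in _ --> X -> _](fineK fi).
  move/fine_cvgP => [_]; apply: cvg_trans; apply: near_eq_cvg.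
  by apply: nearW => n /=; rewrite E1.
Unshelve. all: by end_near. Qed.
End primitives.

(** * Monotone transport between two positive densities *)

Section transport.
Variable R : realType.
Notation mu := (@lebesgue_measure R).

(** A strictly increasing function lies between its limits at the two ends. Strictness at [x] comes
    from the weak bounds at [x / 2] and [2 * x]. *)
Lemma primitive_bounds (f L : R -> R) (I : R) :
  (forall x : R, 0 < x -> is_derive x 1 L (f x)) -> (forall x, 0 < x -> 0 < f x) ->
  L x @[x --> 0] --> (0 : R) -> L n%:R @[n --> \oo] --> I ->
  forall x, 0 < x -> 0 < L x < I.
Proof.
move=> dL f0 L0 LI.
have Lincr x y : 0 < x -> x < y -> L x < L y.
  move=> x0 xy; apply: (@increasing_of_is_derive _ _ f) => //.
    by move=> z /andP[xz _]; apply: dL; exact: lt_le_trans xz.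
  by move=> z /andP[xz _]; apply: f0; exact: lt_le_trans xz.
have L_ge0 x : 0 < x -> 0 <= L x.
  move=> x0; rewrite leNgt; apply/negP => Lx0.
  have e0 : 0 < - L x by rewrite oppr_gt0.
  move/cvgrPdist_lt : L0 => /(_ _ e0)[d /= d0 H].
  (* A point below both [x] and [d]: monotonicity gives L y < L x < 0, while the limit at 0 gives |L
     y| < - L x. *)
  pose y := Num.min x d / 2.
  have y0 : 0 < y by rewrite divr_gt0// lt_min x0 d0.
  have yx : y < x.
    have : Num.min x d <= x by rewrite ge_min lexx.
    by rewrite /y; lra.
  have yd : y < d.
    have : Num.min x d <= d by rewrite ge_min lexx orbT.
    by rewrite /y; lra.
  have := H y; rewrite /ball_/= !sub0r !normrN (gtr0_norm y0) => /(_ yd).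
  have := Lincr _ _ y0 yx.
  move=> Lyx; rewrite ltr0_norm; last exact: lt_trans Lx0.
  by rewrite ltrN2 ltNge ltW.
have L_leI x : 0 < x -> L x <= I.
  move=> x0; rewrite leNgt; apply/negP => ILx.
  have e0 : 0 < L x - I by rewrite subr_gt0.
  move/cvgrPdist_lt : LI => /(_ _ e0) H.
  near \oo => n.
  have xn : x < n%:R by near: n; exact: nbhs_infty_gtr.
  have : `|I - L n%:R| < L x - I by near: n.
  have := Lincr _ _ x0 xn; rewrite distrC => Lxn.
  rewrite ger0_norm ?subr_ge0; lra.
move=> x x0.
have h0 : 0 < x / 2 by rewrite divr_gt0.
have hx : x / 2 < x by lra.
have x2 : x < 2 * x by lra.
rewrite (le_lt_trans (L_ge0 _ h0) (Lincr _ _ h0 hx))/=.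
by apply: (lt_le_trans (Lincr _ _ x0 x2)); apply: L_leI; lra.
Unshelve. all: by end_near. Qed.

(** With F and G the primitives of [f] and [k], take T = F^-1 o G. Equal total masses put every
    value of G in the range of F, and differentiating F(T x) = G x gives the Jacobian equation. *)
Lemma monotone_transport (f k : R -> R) :
  (forall x, 0 < x -> {for x, continuous f}) ->
  (forall x, 0 < x -> {for x, continuous k}) ->
  (forall x, 0 < x -> 0 < f x) -> (forall x, 0 < x -> 0 < k x) ->
  mu.-integrable (@posR R) (EFin \o f) -> mu.-integrable (@posR R) (EFin \o k) ->
  fine (\int[mu]_(x in @posR R) (f x)%:E)%E = fine (\int[mu]_(x in @posR R) (k x)%:E)%E ->
  exists T : R -> R, forall x : R, 0 < x ->
    0 < T x /\ is_derive x 1 T (k x / f (T x)).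
Proof.
move=> cf ck f0 k0 intf intk.
have [F [dF F0 Foo]] := improper_primitive cf intf.
have [G [dG G0 Goo]] := improper_primitive ck intk.
move: Foo Goo; set I := fine _; set J := fine _ => Foo Goo IJ.
have Fb := primitive_bounds dF f0 F0 Foo.
have Gb := primitive_bounds dG k0 G0 Goo.
rewrite -IJ in Gb.
have Fincr x y : 0 < x -> x < y -> F x < F y.
  move=> x0 xy; apply: (@increasing_of_is_derive _ _ f) => //.
    by move=> z /andP[xz _]; apply: dF; exact: lt_le_trans xz.
  by move=> z /andP[xz _]; apply: f0; exact: lt_le_trans xz.
have Finj x y : 0 < x -> 0 < y -> F x = F y -> x = y.
  move=> x0 y0 Fxy; have [xy|yx|//] := ltgtP x y.
    by have := Fincr _ _ x0 xy; rewrite Fxy ltxx.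
  by have := Fincr _ _ y0 yx; rewrite Fxy ltxx.
have Fsurj v : 0 < v < I -> exists2 y, 0 < y & F y = v.
  move=> /andP[v0 vI].
  have [a a0 Fav] : exists2 a, 0 < a & F a <= v.
    move/cvgrPdist_lt : F0 => /(_ _ v0)[d /= d0 H].
    exists (d / 2); first by rewrite divr_gt0.
    have := H (d / 2); rewrite /ball_/= !sub0r !normrN.
    rewrite (gtr0_norm (divr_gt0 d0 _))// => /(_ _)/wrap[]; first lra.
    by move=> /ltW; apply: le_trans; exact: ler_norm.
  have [b ab vFb] : exists2 b, a <= b & v <= F b.
    have e0 : 0 < I - v by rewrite subr_gt0.
    move/cvgrPdist_lt : Foo => /(_ _ e0) H.
    near \oo => n; exists n%:R; first by near: n; exact: nbhs_infty_ger.
    have : `|I - F n%:R| < I - v by near: n.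
    by move=> /(le_lt_trans (ler_norm _)); lra.
  have cF : {within `[a, b], continuous F}.
    apply: derivable_within_continuous => x; rewrite in_itv/= => /andP[ax _].
    exact: (@ex_derive _ _ _ _ _ _ _ (dF x (lt_le_trans a0 ax))).
  have [|c] := @IVT R F a b v ab cF.
    by rewrite ge_min Fav/= le_max vFb orbT.
  rewrite in_itv/= => /andP[ac _] Fc; exists c => //; exact: lt_le_trans ac.
(* The default 1 is returned only for [v] outside the range of [F], where [Fi] is never
   evaluated. *)
pose Fi v := xget 1 [set y : R | 0 < y /\ F y = v].
have FiP v : 0 < v < I -> 0 < Fi v /\ F (Fi v) = v.
  move=> /Fsurj[y y0 Fy].
  exact: (@xgetPex _ 1 [set y : R | 0 < y /\ F y = v]) (ex_intro _ y (conj y0 Fy)).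
have FK y : 0 < y -> Fi (F y) = y.
  by move=> y0; have [? ?] := FiP _ (Fb _ y0); exact: Finj.
exists (Fi \o G) => x x0.
have [Tx0 FTx] := FiP _ (Gb _ x0).
split=> //.
have dFi : is_derive (G x) 1 Fi (f (Fi (G x)))^-1.
  rewrite -[in X in is_derive X]FTx.
  apply: (@is_derive_inverse R F).
  - by near=> y; apply: FK; near: y; exact: lt_nbhsr.
  - near=> y; apply/differentiable_continuous/derivable1_diffP.
    have y0 : 0 < y by near: y; exact: lt_nbhsr.
    exact: (@ex_derive _ _ _ _ _ _ _ (dF y y0)).
  - exact: dF.
  - by rewrite gt_eqF// f0.
have dGx := dG _ x0.
by have := @is_derive1_comp R Fi G x _ _ dFi dGx; rewrite mulrC.
Unshelve. all: by end_near. Qed.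
End transport.

(** * Decay estimates for powers times exp(- m / x) *)

Section weight.
Variable R : realType.
Notation mu := (@lebesgue_measure R).
Implicit Types x y r s : R.

Lemma powR_add x r s : 0 < x -> x `^ (r + s) = x `^ r * x `^ s.
Proof. by move=> x0; rewrite powRD// (gt_eqF x0) implybT. Qed.

Lemma ln_le_sub1 x : 0 < x -> ln x <= x - 1.
Proof. by move=> x0; have := @le_ln1Dx R (x - 1); rewrite subrKC; apply; lra. Qed.

(** The constant is the maximum, attained at x = m / p; the bound is ln z <= z - 1 taken at z = m /
    (p x). *)
Lemma powR_expRN_bounded p m : 0 < p -> 0 < m ->
  exists c, forall x, 0 < x -> x `^ (- p) * expR (- (m / x)) <= c.
Proof.
move=> p0 m0; exists (expR (p * (ln p - ln m) - p)) => x x0.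
rewrite /powR gt_eqF// -expRD ler_expR.
have z0 : 0 < m / (p * x) by rewrite divr_gt0 ?mulr_gt0.
have := ln_le_sub1 z0.
rewrite ln_div ?posrE ?mulr_gt0// lnM ?posrE//.
rewrite -(ler_pM2l p0) => H.
have E : p * (m / (p * x) - 1) = m / x - p by field; rewrite !gt_eqF.
by move: H; rewrite E; lra.
Qed.

(** Expand (1 + x)^2 and bound the three terms separately, with exponents [s - 2], [s - 1] and [s],
    all positive. *)
Lemma powR_expRN_tail s m : 2 < s -> 0 < m ->
  exists c, forall x, 0 < x -> x `^ (- s) * expR (- (m / x)) <= c / (1 + x) ^+ 2.
Proof.
move=> s2 m0.
have [c1 H1] := @powR_expRN_bounded (s - 2) m (ltac:(lra)) m0.
have [c2 H2] := @powR_expRN_bounded (s - 1) m (ltac:(lra)) m0.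
have [c3 H3] := @powR_expRN_bounded s m (ltac:(lra)) m0.
exists (c1 + 2 * c2 + c3) => x x0.
rewrite ler_pdivlMr; last by rewrite exprn_gt0// addr_gt0.
move: (H1 _ x0) (H2 _ x0) (H3 _ x0).
rewrite (_ : - (s - 2) = - s + 1 + 1); last by ring.
rewrite (_ : - (s - 1) = - s + 1); last by ring.
rewrite !powR_add// (powRr1 (ltW x0)).
set a := x `^ _; set b := expR _ => h1 h2 h3.
have -> : a * b * (1 + x) ^+ 2 = a * x * x * b + 2 * (a * x * b) + a * b by ring.
by rewrite !lerD// ler_pM2l.
Qed.

(** The comparison function for [hraw]. Its integral over [0, +oo[ is 1, computed with the primitive
    - 1 / (1 + x). *)
Lemma integrable_invsqr1D : mu.-integrable (@posR R) (fun x => ((1 + x) ^- 2)%:E).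
Proof.
have cf x : 0 <= x -> {for x, continuous (fun x : R => (1 + x) ^- 2)}.
  move=> x0; apply: cvgV; first by rewrite expf_neq0// gt_eqF// ltr_wpDr.
  by apply: cvgM; apply: cvgD; [exact: cvg_cst|exact: cvg_id|exact: cvg_cst|exact: cvg_id].
have cf' : {within `[0, +oo[, continuous (fun x : R => (1 + x) ^- 2)}.
  apply: continuous_in_subspaceT => x /set_mem/=; rewrite in_itv/= andbT.
  exact: cf.
have I1 : (\int[mu]_(x in `[0%R, +oo[) ((1 + x) ^- 2)%:E)%E = 1%E.
  pose F := fun x : R => - (1 + x)^-1.
  have dF x : 0 <= x -> is_derive x 1 F ((1 + x) ^- 2).
    move=> x0; have x1 : 1 + x != 0 by rewrite gt_eqF// ltr_wpDr.
    have H : is_derive x 1 (fun y : R => 1 + y) (0 + 1) by exact: is_deriveD.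
    have := @is_deriveN _ _ _ _ _ _ _ (is_deriveV x1 H).
    by move/is_derive_eq; apply; rewrite add0r /GRing.scale/= mulr1 opprK.
  rewrite (@ge0_continuous_FTC2y _ _ F 0 0)//.
  - by rewrite /F addr0 invr1 -EFinN -EFinD opprK add0r.
  - by move=> x x0; rewrite invr_ge0 exprn_ge0// addr_ge0.
  - rewrite -oppr0; apply: cvgN; apply/cvgrPdist_le => /= e e0; near=> x.
    have x0 : e^-1 < x by near: x; apply: nbhs_pinfty_gt; rewrite num_real.
    have x1 : 0 < x by apply: lt_trans x0; rewrite invr_gt0.
    rewrite sub0r normrN gtr0_norm ?invr_gt0 ?addr_gt0//.
    rewrite -[leRHS]invrK lef_pV2 ?posrE ?invr_gt0 ?addr_gt0//.
    by rewrite (le_trans (ltW x0))// lerDr.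
  - by move=> x x0; exact: (@ex_derive _ _ _ _ _ _ _ (dF x (ltW x0))).
  - apply: cvg_at_right_filter; apply/differentiable_continuous/derivable1_diffP.
    exact: (@ex_derive _ _ _ _ _ _ _ (dF 0 (lexx _))).
  - move=> x; rewrite in_itv/= andbT => x0; rewrite derive1E.
    exact: (@derive_val _ _ _ _ _ _ _ (dF x (ltW x0))).
apply/integrableP; split.
  apply/measurable_EFinP; apply: measurable_fun_posR => x x0; exact: cf (ltW x0).
rewrite (le_lt_trans _ (ltry 1))// -I1.
under eq_integral do rewrite /= ger0_norm ?invr_ge0 ?sqr_ge0//.
apply: ge0_subset_integral => //.
- exact: measurable_posR.
- by apply/measurable_EFinP; exact: subspace_continuous_measurable_fun.
- by move=> x _; rewrite lee_fin invr_ge0 sqr_ge0.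
- by apply: subset_itvr; rewrite bnd_simp.
Unshelve. all: by end_near. Qed.

End weight.

(** * The natural coordinate, the potential and its uniform convexity *)

Section curvature.
Variable R : realType.
Variables beta alpha m : R.
Implicit Types x y : R.

(* In the coordinate u = natcoord x one has du = - x `^ (- alpha) dx, so
   E[X^(2 alpha) phi'(X)^2] is the mean of (d phi / du)^2, and the law of X has
   density proportional to expR (- potential) with respect to du. *)
Definition natcoord x : R := x `^ (1 - alpha) / (alpha - 1).
Definition potential x : R := (2 * beta - alpha) * ln x + m / x.
(* The derivative of the potential in u; curvature is its second derivative. *)
Definition potential' x : R :=
  m * x `^ (alpha - 2) - (2 * beta - alpha) * x `^ (alpha - 1).
Definition curvature x : R :=
  (2 * beta - alpha) * (alpha - 1) * x `^ (2 * alpha - 2)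
  + m * (2 - alpha) * x `^ (2 * alpha - 3).

Local Notation u := natcoord.
Local Notation V := potential.
Local Notation V' := potential'.

(** The factor x^(- alpha) is the Jacobian |du/dx| of the change of coordinate. *)
Lemma hraw_potential x : 0 < x ->
  hraw beta m x = expR (- V x) * x `^ (- alpha).
Proof.
move=> x0; rewrite /hraw /powR gt_eqF// -!expRD /potential.
by congr expR; ring.
Qed.

Lemma is_derive_natcoord x : 1 < alpha -> 0 < x -> is_derive x 1 u (- x `^ (- alpha)).
Proof.
move=> alpha1 x0; have a1 : alpha - 1 != 0 by rewrite gt_eqF// subr_gt0.
have H : is_derive x 1 u _ := is_derive1M
  (is_derive1_powR (1 - alpha) x0) (is_derive_cst (alpha - 1)^-1 x 1).
move: H => /is_derive_eq; apply; rewrite /cst mulr0 addr0.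
rewrite (_ : 1 - alpha - 1 = - alpha); last by ring.
by field.
Qed.

Lemma is_derive_potential x : 0 < x ->
  is_derive x 1 V (- (x `^ (- alpha) * V' x)).
Proof.
move=> x0; have xn0 : x != 0 by rewrite gt_eqF.
have := is_derive1D (is_derive1Z (2 * beta - alpha) (is_derive1_ln x0))
  (is_derive1Z m (is_derive1V xn0)).
move=> /is_derive_eq; apply.
rewrite /potential' (_ : alpha - 2 = alpha - 1 - 1); last by ring.
rewrite !powR_add// (_ : x `^ (-1) = x^-1); last by rewrite powR_inv1// ltW.
rewrite powRN; field.
by rewrite xn0 gt_eqF ?powR_gt0.
Qed.

Lemma is_derive_potential' x : 0 < x ->
  is_derive x 1 V' (- (x `^ (- alpha) * curvature x)).
Proof.
move=> x0.
have := is_derive1B (is_derive1Z m (is_derive1_powR (alpha - 2) x0))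
  (is_derive1Z (2 * beta - alpha) (is_derive1_powR (alpha - 1) x0)).
move=> /is_derive_eq; apply.
rewrite /curvature.
rewrite (_ : alpha - 2 - 1 = - alpha + (2 * alpha - 3)); last by ring.
rewrite (_ : alpha - 1 - 1 = - alpha + (2 * alpha - 2)); last by ring.
by rewrite !powR_add//; ring.
Qed.

(** The exponential lies above its tangent at w = q ln a + p ln b. Averaging the tangent bounds for
    [a] and [b] with weights [q] and [p] cancels the linear terms and leaves exp w. *)
Lemma weighted_AMGM (p q a b : R) : 0 < a -> 0 < b -> 0 <= p -> 0 <= q ->
  p + q = 1 -> a `^ q * b `^ p <= q * a + p * b.
Proof.
move=> a0 b0 p0 q0 pq.
have tangent (w t : R) : 0 < t -> expR w * (1 + (ln t - w)) <= t.
  move=> t0; rewrite -[leRHS](lnK t0) -[in leRHS](subrKC w (ln t)) expRD.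
  by rewrite ler_pM2l ?expR_gt0// expR_ge1Dx.
rewrite /powR !gt_eqF// -expRD; set w := _ + _.
have Ha := tangent w _ a0; have Hb := tangent w _ b0.
have := lerD (ler_wpM2l q0 Ha) (ler_wpM2l p0 Hb); apply: le_trans.
have pE : p = 1 - q by lra.
rewrite le_eqVlt; apply/orP; left; apply/eqP.
rewrite {1}(_ : expR w = expR w * (1 + (q * ln a + p * ln b - w))); last first.
  by rewrite subrr addr0 mulr1.
by rewrite pE; ring.
Qed.

(** For alpha < 3/2 the curvature is q a + p b with weights q = 3 - 2 alpha and p = 2 alpha - 2. The
    powers of x in a and b are chosen so that they cancel in a^q b^p, which equals [rho]. *)
Lemma rho_le_curvature x : 0 < m -> 1 < alpha -> alpha <= 3 / 2 ->
  alpha < beta -> 0 < x -> rho beta alpha m <= curvature x.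
Proof.
move=> m0 alpha1 alpha32 ab x0; rewrite /rho /curvature.
have [a32|a32] := ltP alpha (3 / 2); last first.
  (* At alpha = 3/2 the second term of the curvature is the constant m / 2, and the first is
     nonnegative. *)
  have -> : 2 * alpha - 3 = 0 by lra.
  rewrite powRr0 mulr1.
  have : 0 <= (2 * beta - alpha) * (alpha - 1) * x `^ (2 * alpha - 2).
    by rewrite !mulr_ge0 ?powR_ge0//; lra.
  have : m / 2 <= m * (2 - alpha) by rewrite ler_pM2l//; lra.
  by lra.
pose p : R := 2 * alpha - 2; pose q : R := 3 - 2 * alpha.
have p0 : 0 < p by rewrite /p; lra.
have q0 : 0 < q by rewrite /q; lra.
have pq : p + q = 1 by rewrite /p /q; ring.
have A0 : 0 < 2 * beta - alpha by lra.
have a1 : 0 < alpha - 1 by lra.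
have a2 : 0 < 2 - alpha by lra.
pose a := (2 * beta - alpha) * (alpha - 1) * x `^ p / q.
pose b := m * (2 - alpha) * x `^ (- q) / p.
have a0 : 0 < a by rewrite !mulr_gt0 ?powR_gt0 ?invr_gt0.
have b0 : 0 < b by rewrite !mulr_gt0 ?powR_gt0 ?invr_gt0.
have := weighted_AMGM a0 b0 (ltW p0) (ltW q0) pq.
rewrite (_ : q * a + p * b = (2 * beta - alpha) * (alpha - 1) * x `^ (2 * alpha - 2)
  + m * (2 - alpha) * x `^ (2 * alpha - 3)); last first.
  rewrite /a /b (_ : - q = 2 * alpha - 3); last by rewrite /q; ring.
  by rewrite -/p; field; rewrite !gt_eqF.
apply: le_trans; rewrite le_eqVlt; apply/orP; left; apply/eqP.
have h2 : 0 < 2 * (alpha - 1) :> R by lra.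
have h3 : 0 < 3 / 2 - alpha by lra.
have pE : p = 2 * (alpha - 1) by rewrite /p; ring.
have qE : q = 2 * (3 / 2 - alpha) by rewrite /q; field.
(* Taking logarithms turns the identity between products of powers into a polynomial identity in the
   logarithms. *)
apply: ln_inj.
- by rewrite posrE !mulr_gt0 ?powR_gt0 ?invr_gt0 ?mulr_gt0 ?invr_gt0.
- by rewrite posrE !mulr_gt0 ?powR_gt0.
rewrite /a /b !(lnM, ln_powR, ln_div, lnV) ?posrE ?mulr_gt0 ?powR_gt0
  ?invr_gt0 ?mulr_gt0 ?invr_gt0//; [|exact: powR_gt0..].
have lp : ln p = ln 2 + ln (alpha - 1) by rewrite pE lnM ?posrE.
have lq : ln q = ln 2 + ln (3 / 2 - alpha) by rewrite qE lnM ?posrE.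
rewrite lp lq /p /q; ring.
Qed.

(** The quadratic lower bound at [x] for a function of u whose second derivative is at least
    [rh]. *)
Lemma potential_convex (rh x y : R) : 1 < alpha ->
  (forall z, 0 < z -> rh <= curvature z) ->
  0 < x -> 0 < y ->
  V' x * (u y - u x) + rh / 2 * (u y - u x) ^+ 2 <= V y - V x.
Proof.
move=> alpha1 rhc x0 y0.
(* [Q] is nondecreasing in u, hence nonincreasing in the variable [z], because u decreases. *)
pose Q z := V' z - rh * u z.
have Qmono z w : 0 < z -> z <= w -> Q w <= Q z.
  move=> z0 zw; rewrite -lerN2.
  apply: (@nondecreasing_of_is_derive _ (fun t => - Q t)
     (fun t => t `^ (- alpha) * (curvature t - rh))) => //.
    move=> t /andP[zt _]; have t0 := lt_le_trans z0 zt.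
    have := is_derive1N (is_derive1B (is_derive_potential' t0)
      (is_derive1Z rh (is_derive_natcoord alpha1 t0))).
    by move=> /is_derive_eq; apply; ring.
  move=> t /andP[zt _]; have t0 := lt_le_trans z0 zt.
  by rewrite mulr_ge0 ?powR_ge0// subr_ge0 rhc.
(* The gap between V and its quadratic lower bound. Its derivative has the sign of Q x - Q t, so [W]
   is minimal at [x]; the cases x <= y and y < x are treated separately below. *)
pose W t := V t - V' x * (u t - u x) - rh / 2 * (u t - u x) ^+ 2.
have dW (t : R) : 0 < t -> is_derive t 1 W (t `^ (- alpha) * (Q x - Q t)).
  move=> t0.
  have du : is_derive t 1 (fun z => u z - u x) (- t `^ (- alpha)).
    exact: is_derive1B_cst (is_derive_natcoord alpha1 t0).
  have := is_derive1B (is_derive1B (is_derive_potential t0)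
      (is_derive1Z (V' x) du)) (is_derive1Z (rh / 2) (is_derive1M du du)).
  move=> /is_derive_eq; apply.
  by rewrite /Q; field.
suff : W x <= W y by rewrite /W !subrr expr0n/= !mulr0 !subr0; lra.
have [xy|yx] := leP x y.
  apply: (nondecreasing_of_is_derive xy) => [t /andP[xt _]|t /andP[xt _]].
    by apply: dW; exact: lt_le_trans xt.
  by rewrite mulr_ge0 ?powR_ge0// subr_ge0 Qmono.
rewrite -lerN2; apply: (@nondecreasing_of_is_derive _ (fun t => - W t)
     (fun t => - (t `^ (- alpha) * (Q x - Q t))) _ _ (ltW yx)).
  by move=> t /andP[yt _]; apply: is_derive1N; apply: dW; exact: lt_le_trans yt.
move=> t /andP[yt tx]; rewrite -mulrN mulr_ge0 ?powR_ge0// opprB subr_ge0.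
by apply: Qmono => //; exact: lt_le_trans yt.
Qed.

End curvature.

(** * Positivity, continuity and normalization of the density *)

Section density.
Variable R : realType.
Variables beta m : R.
Notation mu := (@lebesgue_measure R).
Implicit Types x y : R.

Lemma hraw_gt0 x : 0 < x -> 0 < hraw beta m x.
Proof. by move=> x0; rewrite mulr_gt0 ?powR_gt0 ?expR_gt0. Qed.

Lemma hraw_continuous x : 0 < x -> {for x, continuous (hraw beta m)}.
Proof.
move=> x0.
have xn0 : x != 0 by rewrite gt_eqF.
have dE : is_derive x 1 (expR \o (fun y => - (m * y^-1))) _ :=
  is_derive1_comp (is_derive_expR _) (is_derive1N (is_derive1Z m (is_derive1V xn0))).
exact: is_derive1_continuous (is_derive1M (is_derive1_powR (- (2 * beta)) x0) dE).
Qed.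

Lemma integrable_hraw : 1 < beta -> 0 < m ->
  mu.-integrable (@posR R) (fun x => (hraw beta m x)%:E).
Proof.
move=> b1 m0.
have [c cP] := @powR_expRN_tail R (2 * beta) m (ltac:(lra)) m0.
apply: (@le_integrable _ _ _ mu _ _ _ (fun x => (c * (1 + x) ^- 2)%:E)).
- exact: measurable_posR.
- apply/measurable_EFinP; apply: measurable_fun_posR; exact: hraw_continuous.
- move=> x /posRE x0; rewrite !abse_EFin lee_fin.
  rewrite gtr0_norm ?hraw_gt0// (le_trans (cP _ x0))//; exact: ler_norm.
- under eq_fun do rewrite EFinM.
  apply: integrableZl; first exact: measurable_posR.
  exact: integrable_invsqr1D.
Qed.

(** The total mass of [hraw] is positive because the value at 1 of its primitive lies strictly
    between 0 and that mass. *)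
Lemma Cbm_gt0 : 1 < beta -> 0 < m -> 0 < Cbm beta m.
Proof.
move=> b1 m0; rewrite invr_gt0.
have [L [dL L0 Loo]] := improper_primitive hraw_continuous (integrable_hraw b1 m0).
have /andP[] := primitive_bounds dL hraw_gt0 L0 Loo (@ltr01 R).
exact: lt_trans.
Qed.

Lemma hdens_gt0 x : 1 < beta -> 0 < m -> 0 < x -> 0 < hdens beta m x.
Proof. by move=> b1 m0 x0; rewrite mulr_gt0 ?Cbm_gt0 ?hraw_gt0. Qed.

Lemma hdens_continuous x : 0 < x -> {for x, continuous (hdens beta m)}.
Proof. by move=> x0; apply: cvgM; [exact: cvg_cst|exact: hraw_continuous]. Qed.

Lemma integrable_hdens : 1 < beta -> 0 < m ->
  mu.-integrable (@posR R) (fun x => (hdens beta m x)%:E).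
Proof.
move=> b1 m0; under eq_fun do rewrite EFinM.
by apply: integrableZl; [exact: measurable_posR|exact: integrable_hraw].
Qed.

Lemma integral_hdens : 1 < beta -> 0 < m ->
  (\int[mu]_(x in @posR R) (hdens beta m x)%:E = 1)%E.
Proof.
move=> b1 m0; under eq_integral do rewrite EFinM.
rewrite integralZl//; [|exact: measurable_posR|exact: integrable_hraw].
have fi : (\int[mu]_(x in @posR R) (hraw beta m x)%:E)%E \is a fin_num.
  by apply: integrable_fin_num; [exact: measurable_posR|exact: integrable_hraw].
rewrite -(fineK fi) -EFinM mulVf//.
by rewrite -invr_eq0 gt_eqF// Cbm_gt0.
Qed.

Lemma integrable_bounded_hdens (f : R -> R) M : 1 < beta -> 0 < m ->
  measurable_fun (@posR R) f -> (forall x, 0 < x -> `|f x| <= M) ->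
  mu.-integrable (@posR R) (fun x => (f x * hdens beta m x)%:E).
Proof.
move=> b1 m0 mf fM.
apply: (@le_integrable _ _ _ mu _ _ _ (fun x => (M * hdens beta m x)%:E)).
- exact: measurable_posR.
- apply/measurable_EFinP; apply: measurable_funM => //.
  by apply: measurable_fun_posR; exact: hdens_continuous.
- move=> x /posRE x0; rewrite !abse_EFin lee_fin !normrM ler_wpM2r//.
  by rewrite (le_trans (fM _ x0))// ler_norm.
- under eq_fun do rewrite EFinM.
  by apply: integrableZl; [exact: measurable_posR|exact: integrable_hdens].
Qed.

End density.

(** * The pointwise transport inequality and the derivative of the flux *)

Section entropy_production.
Variable R : realType.
Variables beta alpha m : R.
Notation mu := (@lebesgue_measure R).
Implicit Types x y : R.
Local Notation u := (natcoord alpha).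
Local Notation V := (potential beta alpha m).
Local Notation V' := (potential' beta alpha m).
Local Notation h := (hdens beta m).
Local Notation C := (Cbm beta m).

Lemma natcoord_gt0 x : 1 < alpha -> 0 < x -> 0 < u x.
Proof. by move=> a1 x0; rewrite divr_gt0 ?powR_gt0// subr_gt0. Qed.

Lemma natcoord_surj (B : R) : 1 < alpha -> 0 < B -> exists2 x, 0 < x & u x = B.
Proof.
move=> a1 B0; have a10 : 0 < alpha - 1 by lra.
have AB0 : 0 < (alpha - 1) * B by rewrite mulr_gt0.
exists (((alpha - 1) * B) `^ (1 - alpha)^-1); first exact: powR_gt0.
rewrite /natcoord -powRrM mulVf; last by rewrite lt_eqF//; lra.
by rewrite (powRr1 (ltW AB0)) mulrC mulKf// gt_eqF.
Qed.

Lemma natcoord_nonincreasing x y : 1 < alpha -> 0 < x -> x <= y -> u y <= u x.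
Proof.
move=> a1 x0 xy; rewrite -lerN2.
apply: (@nondecreasing_of_is_derive _ (fun t => - u t) (fun t => t `^ (- alpha))) => //.
  move=> t /andP[xt _]; have t0 := lt_le_trans x0 xt.
  by have := is_derive1N (is_derive_natcoord a1 t0); rewrite opprK.
by move=> t _; exact: powR_ge0.
Qed.

Lemma hdens_potential x : 0 < x -> h x = C * (expR (- V x) * x `^ (- alpha)).
Proof. by move=> x0; rewrite /hdens (hraw_potential _ alpha). Qed.

(** This form shows the decay at infinity: the exponent 1 - 2 beta is below -1 when beta > 1. *)
Lemma natcoord_expRN_potential x : 0 < x ->
  u x * expR (- V x) = x `^ (1 - 2 * beta) * expR (- (m / x)) / (alpha - 1).
Proof.
move=> x0; rewrite /natcoord mulrAC; congr (_ / _).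
rewrite /powR gt_eqF// -!expRD /potential.
by congr expR; ring.
Qed.

(** Brings u h into the form covered by [powR_expRN_tail]; the exponent 2 beta + alpha - 1 exceeds 2
    when alpha, beta > 1. *)
Lemma natcoord_hraw x : 0 < x ->
  u x * hraw beta m x =
    x `^ (- (2 * beta + alpha - 1)) * expR (- (m / x)) / (alpha - 1).
Proof.
move=> x0; rewrite /natcoord /hraw mulrAC; congr (_ / _).
by rewrite mulrA -powR_add//; congr (_ `^ _ * _); ring.
Qed.

(** Here [y] stands for T x, and g exp(V y - V x) is then tau by the Jacobian equation. Convexity of
    V bounds the change of potential from below. *)
Lemma transport_pointwise (rh x y g dg : R) : 1 < alpha -> 0 < rh ->
  (forall z, 0 < z -> rh <= curvature beta alpha m z) ->
  0 < x -> 0 < y -> 0 < g ->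
  g * ln g - (2 * rh)^-1 * (x `^ (2 * alpha) * dg ^+ 2 / g) <=
  g * (g * expR (V y - V x) - 1 - (u y - u x) * V' x)
  - x `^ alpha * dg * (u y - u x).
Proof.
move=> a1 rh0 rhc x0 y0 g0.
have := potential_convex a1 rhc x0 y0; set D := u y - u x => conv.
have lng : ln g <= g * expR (V y - V x) - 1 - (V y - V x).
  have t0 : 0 < g * expR (V y - V x) by rewrite mulr_gt0 ?expR_gt0.
  by have := ln_le_sub1 t0; rewrite lnM ?posrE ?expR_gt0// expRK; lra.
have H1 : g * ln g <=
    g * (g * expR (V y - V x) - 1 - (V' x * D + rh / 2 * D ^+ 2)).
  by rewrite ler_pM2l//; lra.
rewrite (_ : 2 * alpha = alpha + alpha); last by ring.
rewrite powR_add//; set w := x `^ alpha.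
(* Young's inequality as a completed square; up to sign, [w * dg] is the derivative of g in u. *)
have H2 : 0 <= (2 * rh * g)^-1 * (w * dg - rh * g * D) ^+ 2.
  by rewrite mulr_ge0 ?sqr_ge0// invr_ge0 !mulr_ge0// ltW.
have E2 : (2 * rh * g)^-1 * (w * dg - rh * g * D) ^+ 2 =
    (2 * rh)^-1 * (w * w * dg ^+ 2 / g) - w * dg * D + rh / 2 * D ^+ 2 * g.
  by field; rewrite !gt_eqF.
rewrite E2 in H2.
apply: le_trans (_ : _ <= g * (g * expR (V y - V x) - 1 -
   (V' x * D + rh / 2 * D ^+ 2)) - (w * dg * D - rh / 2 * D ^+ 2 * g)) _.
  by rewrite lerB//; lra.
by rewrite le_eqVlt; apply/orP; left; apply/eqP; ring.
Qed.

(** The derivative of the flux in x is minus the right-hand side of [transport_pointwise] times h.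
    The sign comes from u being decreasing in x. *)
Lemma is_derive_transport_flux (g T : R -> R) (dg x : R) : 1 < alpha -> 1 < beta ->
  0 < m -> 0 < x -> 0 < T x -> is_derive x 1 g dg ->
  is_derive x 1 T (g x * h x / h (T x)) ->
  is_derive x 1 (fun z => C * (g z * (u (T z) - u z) * expR (- V z)))
    (- ((g x * (g x * expR (V (T x) - V x) - 1 - (u (T x) - u x) * V' x)
        - x `^ alpha * dg * (u (T x) - u x)) * h x)).
Proof.
move=> a1 b1 m0 x0 Tx0 dgx dT.
have duT := is_derive1_comp (is_derive_natcoord a1 Tx0) dT.
have dD := is_derive1B duT (is_derive_natcoord a1 x0).
have dE := @is_derive1_comp R expR (fun z => - V z) x _ _ (is_derive_expR (- V x))
  (is_derive1N (is_derive_potential beta alpha m x0)).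
have := is_derive1Z C (is_derive1M (is_derive1M dgx dD) dE).
move=> /is_derive_eq; apply.
rewrite /= !hdens_potential// expRD.
rewrite [expR (- V (T x))]expRN !powRN.
have : C != 0 by rewrite gt_eqF// Cbm_gt0.
have : x `^ alpha != 0 by rewrite gt_eqF// powR_gt0.
have : (T x) `^ alpha != 0 by rewrite gt_eqF// powR_gt0.
have : expR (V (T x)) != 0 by rewrite gt_eqF// expR_gt0.
(* Powers and exponentials become nonzero atoms, so that [field] only sees rational functions. *)
move: (x `^ _) (T x `^ _) (expR (V (T x))) (expR (- V x)) => p q r s.
move: (Cbm _ _) => c n1 n2 n3 n4; field.
by rewrite n1 n2 n3 n4.
Qed.

End entropy_production.

(** * Bounds on x ln x and on the flux at the two ends *)

Section log_sobolev.
Variable R : realType.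
Variables beta alpha m : R.
Notation mu := (@lebesgue_measure R).
Implicit Types x y : R.
Local Notation u := (natcoord alpha).
Local Notation V := (potential beta alpha m).
Local Notation h := (hdens beta m).
Local Notation C := (Cbm beta m).

(** Both sides come from ln z <= z - 1, at z = 1 / x and at z = x: x - 1 <= x ln x <= x (x - 1). *)
Lemma xlnx_bounded (M x : R) : 0 < x <= M -> `|x * ln x| <= 1 + M ^+ 2.
Proof.
move=> /andP[x0 xM]; rewrite ler_norml; apply/andP; split.
  have ix0 : 0 < x^-1 by rewrite invr_gt0.
  have := ln_le_sub1 ix0; rewrite lnV ?posrE// -(ler_pM2l x0).
  rewrite mulrBr mulfV ?gt_eqF//.
  have := sqr_ge0 M; lra.
have := ln_le_sub1 x0; rewrite -(ler_pM2l x0) => /le_trans; apply.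
have : x * x <= M ^+ 2 by rewrite expr2 ler_pM// ltW.
lra.
Qed.

Lemma flux_at_infinity (g T : R -> R) (M e : R) : 1 < beta -> 0 < m -> 1 < alpha ->
  (forall x, 0 < x -> 0 < g x <= M) -> (forall x, 0 < x -> 0 < T x) -> 0 < e ->
  \forall n \near \oo,
    - e <= C * (g n%:R * (u (T n%:R) - u n%:R) * expR (- V n%:R)).
Proof.
move=> b1 m0 a1 gM T0 e0.
have C0 := Cbm_gt0 b1 m0.
have a10 : 0 < alpha - 1 by lra.
near=> n.
have n1 : 1 <= n%:R :> R by near: n; exact: nbhs_infty_ger.
have n0 : 0 < n%:R :> R by exact: lt_le_trans n1.
have /andP[g0 gnM] := gM _ n0.
have M0 : 0 < M by exact: lt_le_trans gnM.
have nB : C * M / (alpha - 1) / e <= n%:R by near: n; exact: nbhs_infty_ger.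
apply: (@le_trans _ _ (- (C * (g n%:R * (u n%:R * expR (- V n%:R)))))).
  rewrite lerN2 natcoord_expRN_potential//.
  apply: (@le_trans _ _ (C * (M * ((n%:R)^-1 / (alpha - 1))))).
    rewrite ler_pM2l// ler_pM ?(ltW g0)//.
      by rewrite !mulr_ge0 ?powR_ge0 ?expR_ge0 ?invr_ge0// ltW.
    rewrite ler_pM2r ?invr_gt0// -[leRHS]mulr1 ler_pM ?powR_ge0 ?expR_ge0//.
      rewrite -(powR_inv1 (ltW n0)) ler_powR//; lra.
    by rewrite -[leRHS]expR0 ler_expR oppr_le0 divr_ge0// ltW.
  move: nB; rewrite ler_pdivrMr// => nB.
  rewrite (_ : C * _ = C * M / (alpha - 1) / n%:R); last by field; rewrite !gt_eqF.
  by rewrite ler_pdivrMr// [leRHS]mulrC.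
have uT0 := natcoord_gt0 a1 (T0 _ n0).
rewrite (_ : C * (g n%:R * (u (T n%:R) - u n%:R) * _) =
  C * (g n%:R * (u (T n%:R) * expR (- V n%:R)))
  - C * (g n%:R * (u n%:R * expR (- V n%:R)))); last by ring.
rewrite lerDr; apply: mulr_ge0; first exact: ltW.
apply: mulr_ge0; first exact: ltW.
by apply: mulr_ge0; [exact: ltW|exact: expR_ge0].
Unshelve. all: by end_near. Qed.

(* On (0, d) the flux is at most [x `^ alpha] times the derivative of a
   bounded function of [T], whereas [x `^ (- alpha)] is not integrable at 0. *)
Lemma flux_at_zero (g T : R -> R) (d e : R) : 1 < beta -> 0 < m -> 1 < alpha ->
  (forall x, 0 < x -> 0 < g x) -> (forall x, 0 < x -> 0 < T x) ->
  (forall x, 0 < x -> is_derive x 1 T (g x * h x / h (T x))) -> 0 < d -> 0 < e ->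
  exists2 x, 0 < x < d & C * (g x * (u (T x) - u x) * expR (- V x)) < e.
Proof.
move=> b1 m0 a1 g0 T0 dT d0 e0.
have C0 := Cbm_gt0 b1 m0.
have a10 : 0 < alpha - 1 by lra.
have [c cP] := @powR_expRN_tail R (2 * beta + alpha - 1) m (ltac:(lra)) m0.
have c0 : 0 < c.
  have := cP 1 ltr01; rewrite ler_pdivlMr ?exprn_gt0 ?addr_gt0// => /(lt_le_trans _); apply.
  by rewrite !mulr_gt0 ?powR_gt0 ?expR_gt0 ?exprn_gt0 ?addr_gt0.
(* Otherwise the flux is at least [e] on all of (0, d). *)
apply: contrapT => /forall2NP H.
have {}H x : 0 < x -> x < d -> e <= C * (g x * (u (T x) - u x) * expR (- V x)).
  by move=> x0 xd; case: (H x) => [|/negP]; [rewrite x0 xd|rewrite -leNgt].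
pose k := C * (c / (alpha - 1)).
have k0 : 0 < k by apply: mulr_gt0 => //; exact: divr_gt0.
(* The bounded function of T, with values in (-1, 0). *)
pose K x := - (1 + T x)^-1.
have dK x : 0 < x -> is_derive x 1 K ((1 + T x) ^- 2 * (g x * h x / h (T x))).
  move=> x0.
  have T1 : 1 + T x != 0 by rewrite gt_eqF// addr_gt0// T0.
  have d1 : is_derive x 1 (fun y => 1 + T y) (0 + g x * h x / h (T x)).
    exact: (is_derive1D (is_derive_cst (1 : R) x 1) (dT _ x0)).
  have := is_derive1N (@is_derive1_comp R (fun y => y^-1) (fun y => 1 + T y) x _ _
    (is_derive1V T1) d1).
  by move=> /is_derive_eq; apply; rewrite add0r mulNr opprK.
have Kb x : 0 < x -> -1 < K x < 0.
  move=> x0; rewrite ltrN2 oppr_lt0 invr_gt0 addr_gt0 ?T0// andbT.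
  by rewrite invf_lt1 ?addr_gt0 ?T0// ltrDl T0.
(* Dropping - u(x) from the flux gives e <= u(T) g h x^alpha. Since u(T) h(T) <= k / (1 + T)^2, the
   derivative of [K] is at least (e / k) x^(- alpha). *)
have KE x : 0 < x -> x < d -> e / k * x `^ (- alpha) <=
    (1 + T x) ^- 2 * (g x * h x / h (T x)).
  move=> x0 xd; have Tx0 := T0 _ x0; have gx0 := g0 _ x0.
  have hT0 := hdens_gt0 b1 m0 Tx0.
  have xa0 : 0 < x `^ alpha by exact: powR_gt0.
  have uh : u (T x) * h (T x) <= k / (1 + T x) ^+ 2.
    rewrite /hdens mulrCA natcoord_hraw// /k -[leRHS]mulrA ler_pM2l//.
    by rewrite [leRHS]mulrAC ler_pM2r ?invr_gt0//; exact: cP.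
  have flux : e <= u (T x) * (g x * h x) * x `^ alpha.
    apply: (le_trans (H _ x0 xd)); rewrite (hdens_potential beta alpha m x0) powRN.
    rewrite (_ : u (T x) * (g x * (C * (expR (- V x) * (x `^ alpha)^-1))) * x `^ alpha =
      C * (g x * u (T x) * expR (- V x))); last by field; rewrite gt_eqF.
    rewrite ler_pM2l// ler_pM2r ?expR_gt0// ler_pM2l//.
    by rewrite gerBl ltW// natcoord_gt0.
  rewrite powRN ler_pdivrMr// ler_pdivrMr//; apply: (le_trans flux).
  rewrite (_ : _ * k = k / (1 + T x) ^+ 2 * (g x * h x / h (T x) * x `^ alpha)); last by ring.
  rewrite (_ : u (T x) * _ * _ =
    u (T x) * h (T x) * (g x * h x / h (T x) * x `^ alpha)); last first.
    by field; rewrite gt_eqF.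
  have hx0 := hdens_gt0 b1 m0 x0.
  by rewrite ler_pM2r//; do 3?[apply: mulr_gt0 => //]; rewrite invr_gt0.
pose a := d / 2; have ad : a < d by rewrite /a; lra.
have a0 : 0 < a by rewrite divr_gt0.
have mono x : 0 < x -> x <= a -> K x + e / k * u x <= K a + e / k * u a.
  move=> x0 xa.
  apply: (@nondecreasing_of_is_derive _ (fun t => K t + e / k * u t)
    (fun t => (1 + T t) ^- 2 * (g t * h t / h (T t)) + e / k * (- t `^ (- alpha)))) => //.
    move=> t /andP[xt _]; have t0 := lt_le_trans x0 xt.
    exact: is_derive1D (dK _ t0) (is_derive1Z _ (is_derive_natcoord a1 t0)).
  move=> t /andP[xt ta]; have t0 := lt_le_trans x0 xt.
  by rewrite mulrN subr_ge0; apply: KE => //; exact: le_lt_trans ta ad.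
have ek0 : 0 < e / k by rewrite divr_gt0.
(* At the point where u equals [B], monotonicity of K + (e / k) u would give K x + 1 <= K a, against
   -1 < K < 0. *)
pose B := u a + (e / k)^-1.
have iek0 : 0 < (e / k)^-1 by rewrite invr_gt0.
have ua0 := natcoord_gt0 a1 a0.
have [x x0 uxB] := @natcoord_surj R alpha B a1 (addr_gt0 ua0 iek0).
have xa : x <= a.
  rewrite leNgt; apply/negP => /ltW ax.
  have := natcoord_nonincreasing a1 a0 ax; rewrite uxB /B; lra.
have := mono _ x0 xa; rewrite uxB /B mulrDr mulfV ?gt_eqF//.
by have /andP[] := Kb _ x0; have /andP[] := Kb _ a0; lra.
Qed.
End log_sobolev.

(** * Entropy bound for positive densities of mean one *)

Section entropy.
Variable R : realType.
Variables beta alpha m : R.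
Notation mu := (@lebesgue_measure R).
Implicit Types x y : R.
Local Notation u := (natcoord alpha).
Local Notation V := (potential beta alpha m).
Local Notation h := (hdens beta m).
Local Notation C := (Cbm beta m).

(** Let L be the primitive of the difference of the two integrands and Z the flux. L + Z is
    nonincreasing, and Z is controlled at both ends, so the integral of the difference cannot be
    positive. *)
Lemma entropy_le_fisher (g dg : R -> R) (M rh : R) :
  1 < beta -> 0 < m -> 1 < alpha -> 0 < rh ->
  (forall z, 0 < z -> rh <= curvature beta alpha m z) ->
  (forall x, 0 < x -> is_derive x 1 g (dg x)) ->
  (forall x, 0 < x -> {for x, continuous dg}) ->
  (forall x, 0 < x -> 0 < g x <= M) ->
  fine (\int[mu]_(x in @posR R) (g x * h x)%:E)%E = 1 ->
  mu.-integrable (@posR R)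
    (fun x => (x `^ (2 * alpha) * dg x ^+ 2 / g x * h x)%:E) ->
  fine (\int[mu]_(x in @posR R) (g x * ln (g x) * h x)%:E)%E <=
  (2 * rh)^-1 *
    fine (\int[mu]_(x in @posR R) (x `^ (2 * alpha) * dg x ^+ 2 / g x * h x)%:E)%E.
Proof.
move=> b1 m0 a1 rh0 rhc dgx cdg gM g1 intJ.
have g0 x : 0 < x -> 0 < g x by move=> /gM/andP[].
have h0 x : 0 < x -> 0 < h x by exact: hdens_gt0.
have cg x : 0 < x -> {for x, continuous g}.
  by move=> /dgx; exact: is_derive1_continuous.
have ch x : 0 < x -> {for x, continuous h} by exact: hdens_continuous.
have cglng x : 0 < x -> {for x, continuous (fun x => g x * ln (g x))}.
  move=> x0; have dl := is_derive1_comp (is_derive1_ln (g0 _ x0)) (dgx _ x0).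
  exact: is_derive1_continuous (is_derive1M (dgx _ x0) dl).
have intg : mu.-integrable (@posR R) (fun x => (g x * h x)%:E).
  apply: (@integrable_bounded_hdens _ _ _ _ M) => //.
    exact: measurable_fun_posR.
  by move=> x x0; rewrite gtr0_norm ?g0//; have /andP[] := gM _ x0.
have intglng : mu.-integrable (@posR R) (fun x => (g x * ln (g x) * h x)%:E).
  apply: (@integrable_bounded_hdens _ _ _ _ (1 + M ^+ 2)) => //.
    exact: measurable_fun_posR.
  by move=> x x0; exact: xlnx_bounded (gM _ x0).
have [T TP] : exists T : R -> R, forall x : R, 0 < x ->
    0 < T x /\ is_derive x 1 T (g x * h x / h (T x)).
  apply: monotone_transport => //.
  - by move=> x x0; apply: cvgM; [exact: cg|exact: ch].
  - by move=> x x0; rewrite mulr_gt0 ?g0 ?h0.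
  - exact: integrable_hdens.
  - by rewrite integral_hdens// g1.
have T0 x : 0 < x -> 0 < T x by move=> /TP[].
have dT x : 0 < x -> is_derive x 1 T (g x * h x / h (T x)) by move=> /TP[].
pose J x := x `^ (2 * alpha) * dg x ^+ 2 / g x * h x.
pose f x := g x * ln (g x) * h x - (2 * rh)^-1 * J x.
have cJ x : 0 < x -> {for x, continuous J}.
  move=> x0; apply: cvgM; last exact: ch.
  apply: cvgM; last by apply: cvgV; [rewrite gt_eqF ?g0|exact: cg].
  apply: cvgM; first exact: (is_derive1_continuous (is_derive1_powR (2 * alpha) x0)).
  by apply: cvgM; exact: cdg.
have cf x : 0 < x -> {for x, continuous f}.
  move=> x0; apply: cvgB.
    by apply: cvgM; [exact: cglng|exact: ch].
  by apply: cvgM; [exact: cvg_cst|exact: cJ].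
have intcJ : mu.-integrable (@posR R) (fun x => ((2 * rh)^-1 * J x)%:E).
  under eq_fun do rewrite EFinM.
  by apply: integrableZl => //; exact: measurable_posR.
have intf : mu.-integrable (@posR R) (EFin \o f).
  apply: (@integrableB _ _ _ mu (@posR R) _ (fun x => (g x * ln (g x) * h x)%:E)
    (fun x => ((2 * rh)^-1 * J x)%:E)) => //; exact: measurable_posR.
have fE : fine (\int[mu]_(x in @posR R) (f x)%:E)%E =
  fine (\int[mu]_(x in @posR R) (g x * ln (g x) * h x)%:E)%E
  - (2 * rh)^-1 * fine (\int[mu]_(x in @posR R) (J x)%:E)%E.
  have -> : (\int[mu]_(x in @posR R) (f x)%:E =
    \int[mu]_(x in @posR R) (g x * ln (g x) * h x)%:E
    - \int[mu]_(x in @posR R) ((2 * rh)^-1 * J x)%:E)%E.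
    by rewrite -integralB//; exact: measurable_posR.
  rewrite fineB//; [|exact: integral_posR_fin_num..].
  congr (_ - _); under eq_integral do rewrite EFinM.
  rewrite integralZl//; last exact: measurable_posR.
  by rewrite fineM//; exact: integral_posR_fin_num.
rewrite -subr_le0 -fE leNgt; apply/negP; set I := fine _ => I0.
have [L [dL L0 Loo]] := improper_primitive cf intf.
pose Z x := C * (g x * (u (T x) - u x) * expR (- V x)).
(* The derivative of L + Z is the gap in [transport_pointwise], times h. *)
have mono a b : 0 < a -> a <= b -> L b + Z b <= L a + Z a.
  move=> a0 ab; rewrite -lerN2.
  apply: (@nondecreasing_of_is_derive _ (fun t => - (L t + Z t)) (fun x => - (f x
    - (g x * (g x * expR (V (T x) - V x) - 1 - (u (T x) - u x) * potential' beta alpha m x)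
        - x `^ alpha * dg x * (u (T x) - u x)) * h x))) => // x /andP[ax _];
    have x0 := lt_le_trans a0 ax.
    apply: is_derive1N; apply: is_derive1D; first exact: dL.
    by apply: is_derive_transport_flux; rewrite ?T0//; [exact: dgx|exact: dT].
  rewrite oppr_ge0 subr_le0 (_ : f x = (g x * ln (g x)
    - (2 * rh)^-1 * (x `^ (2 * alpha) * dg x ^+ 2 / g x)) * h x); last first.
    by rewrite /f /J mulrBl !mulrA.
  rewrite ler_pM2r ?h0//.
  exact: transport_pointwise (T0 _ x0) (g0 _ x0).
(* With tolerance I / 4 in each of the four estimates, L + Z is below I / 2 at some [x] near 0 and
   above I / 2 at a large [n], contradicting monotonicity. *)
have I4 : 0 < I / 4 by rewrite divr_gt0.
move/cvgrPdist_lt : L0 => /(_ _ I4)[d /= d0 Ld].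
have [x /andP[x0 xd] Zx] := flux_at_zero b1 m0 a1 g0 T0 dT d0 I4.
move/cvgrPdist_lt : Loo => /(_ _ I4) Loo.
near \oo => n.
have xn : x <= n%:R by near: n; exact: nbhs_infty_ger.
have Zn : - (I / 4) <= Z n%:R.
  by near: n; exact: (flux_at_infinity b1 m0 a1 gM T0 I4).
have Ln : I - L n%:R < I / 4.
  by apply: le_lt_trans (ler_norm _) _; near: n.
have Lx : L x < I / 4.
  have := Ld x; rewrite /ball_/= !sub0r !normrN gtr0_norm// => /(_ xd).
  by apply: le_lt_trans; exact: ler_norm.
have := mono _ _ x0 xn; move: Zx; rewrite -/(Z x); lra.
Unshelve. all: by end_near. Qed.
End entropy.

(** * Regularization of phi^2 by a positive constant *)

Section regularization.
Variable R : realType.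
Variables beta alpha m : R.
Notation mu := (@lebesgue_measure R).
Implicit Types x y : R.
Local Notation h := (hdens beta m).

Lemma rho_gt0 : 0 < m -> 1 < alpha -> alpha < beta -> 0 < rho beta alpha m.
Proof.
move=> m0 a1 ab; rewrite /rho; have [a32|a32] := ltP alpha (3 / 2); last by lra.
by rewrite !mulr_gt0 ?powR_gt0 ?mulr_gt0 ?invr_gt0//; lra.
Qed.

(** Superadditivity of s ln s, from the monotonicity of ln applied to each summand. It compares the
    entropy of phi^2 + e with that of phi^2. *)
Lemma xlnx_shift (s e : R) : 0 <= s -> 0 < e ->
  s * ln s + e * ln e <= (s + e) * ln (s + e).
Proof.
move=> s0 e0; rewrite mulrDl lerD//.
  have [->|sn0] := eqVneq s 0; first by rewrite !mul0r.
  have sp : 0 < s by rewrite lt_neqAle eq_sym sn0.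
  by rewrite ler_pM2l// ler_ln ?posrE ?addr_gt0// lerDl ltW.
by rewrite ler_pM2l// ler_ln ?posrE ?ltr_wpDl// lerDr.
Qed.

(** The limit e -> 0 is made quantitative: for any t > 0 an explicit [e] makes the total error at
    most t. *)
Lemma regularized_xlnx_limit (K N A : R) : 0 <= N ->
  (forall e, 0 < e < 1 -> K + e * ln e - (N + e) * ln (N + e) <= A) ->
  K - N * ln N <= A.
Proof.
move=> N0 H; have [NE|Nn0] := eqVneq N 0.
  (* When N = 0 the terms in [e] cancel, so any admissible value will do. *)
  have := H (1 / 2) (ltac:(apply/andP; split; lra)).
  by rewrite NE !add0r mul0r; lra.
have Np : 0 < N by rewrite lt_neqAle eq_sym Nn0.
(* [B] collects the error coefficients: 2 from e ln e, and |ln N| + 1 + 1/N from (N + e) ln (N +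
   e). *)
pose B := 3 + `|ln N| + N^-1.
have iN : 0 < N^-1 by rewrite invr_gt0.
have B0 : 0 < B by have := normr_ge0 (ln N); rewrite /B; lra.
apply/ler_addgt0Pr => t t0.
pose d := Num.min (1 / 2) (t / B).
have d0 : 0 < d by rewrite lt_min; apply/andP; split; [lra|exact: divr_gt0].
have d1 : d < 1 by rewrite gt_min; apply/orP; left; lra.
have dB : d * B <= t by rewrite -ler_pdivlMr// ge_min lexx orbT.
(* With e = d^2, the bound ln (1/d) <= 1/d - 1 gives e ln e >= - 2 d, an error linear in [d]. *)
pose e := d * d.
have e0 : 0 < e by rewrite mulr_gt0.
have ed : e <= d by rewrite ler_piMr ?ltW.
have e1 : e < 1 by exact: le_lt_trans d1.
have lne : - (2 * d) <= e * ln e.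
  have id0 : 0 < d^-1 by rewrite invr_gt0.
  have := ln_le_sub1 id0; rewrite lnV ?posrE// -(ler_pM2l e0).
  have -> : e * (d^-1 - 1) = d - e by rewrite /e; field; rewrite gt_eqF.
  have -> : ln e = 2 * ln d by rewrite /e lnM ?posrE//; ring.
  by move: e0; move: (e) => z; lra.
have lnP : ln (N + e) <= ln N + e * N^-1.
  have -> : N + e = N * (1 + e * N^-1) by field; rewrite gt_eqF.
  have q0 : 0 < e * N^-1 by rewrite mulr_gt0.
  rewrite lnM ?posrE ?addr_gt0// lerD2l le_ln1Dx//; lra.
have PlnP : (N + e) * ln (N + e) <= N * ln N + d * (`|ln N| + 1 + N^-1).
  have P0 : 0 < N + e by rewrite addr_gt0.
  apply: (@le_trans _ _ ((N + e) * (ln N + e * N^-1))); first by rewrite ler_pM2l.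
  rewrite (_ : (N + e) * _ = N * ln N + (e * ln N + e + e * (e * N^-1))); last first.
    by field; rewrite gt_eqF.
  rewrite lerD2l !mulrDr mulr1 !lerD//.
    apply: (@le_trans _ _ (e * `|ln N|)); first by rewrite ler_pM2l// ler_norm.
    by rewrite ler_wpM2r.
  apply: ler_pM; rewrite ?(ltW e0)//; first by rewrite mulr_ge0 ?ltW.
  by rewrite ger_pMl// ltW.
have := H e (ltac:(by rewrite e0 e1)).
have dBE : d * B = 2 * d + d * (`|ln N| + 1 + N^-1) by rewrite /B; ring.
by move: dB; rewrite dBE; lra.
Qed.

Definition has_mean (f : R -> R) :=
  mu.-integrable (@posR R) (fun x => (f x * h x)%:E).

Lemma has_mean_lin (a b : R) (f g : R -> R) : has_mean f -> has_mean g ->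
  has_mean (fun x => a * f x + b * g x).
Proof.
move=> intf intg; rewrite /has_mean.
have -> : (fun x => ((a * f x + b * g x) * h x)%:E) =
    (fun x => (a%:E * (f x * h x)%:E + b%:E * (g x * h x)%:E)%E).
  by apply/funext => x; rewrite -!EFinM -EFinD mulrDl !mulrA.
by apply: integrableD; [exact: measurable_posR| |];
  apply: integrableZl => //; exact: measurable_posR.
Qed.

Lemma mean_lin (a b : R) (f g : R -> R) : has_mean f -> has_mean g ->
  fine (Eh beta m (fun x => a * f x + b * g x)) =
  a * fine (Eh beta m f) + b * fine (Eh beta m g).
Proof.
move=> intf intg; rewrite /Eh.
under eq_integral do rewrite mulrDl -!mulrA EFinD !EFinM.
have Zint c k : has_mean k ->
    mu.-integrable (@posR R) (fun x => (c%:E * (k x * h x)%:E)%E).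
  by move=> intk; apply: integrableZl => //; exact: measurable_posR.
rewrite integralD//; [|exact: measurable_posR|exact: Zint..].
rewrite !integralZl//; [|exact: measurable_posR..].
by rewrite fineD ?fin_numM ?fineM//; exact: integral_posR_fin_num.
Qed.

Lemma le_mean (f g : R -> R) : 1 < beta -> 0 < m -> has_mean f -> has_mean g ->
  (forall x, 0 < x -> f x <= g x) ->
  fine (Eh beta m f) <= fine (Eh beta m g).
Proof.
move=> b1 m0 intf intg fg; apply: fine_le; try exact: integral_posR_fin_num.
apply: le_integral => //; first exact: measurable_posR.
move=> x /set_mem/posRE x0; rewrite lee_fin ler_wpM2r ?fg//.
by rewrite ltW// hdens_gt0.
Qed.

Lemma has_mean_cst (c : R) : 1 < beta -> 0 < m -> has_mean (fun=> c).
Proof.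
by move=> b1 m0; apply: (@integrable_bounded_hdens _ _ _ _ `|c|).
Qed.

Lemma mean1 : 1 < beta -> 0 < m -> fine (Eh beta m (fun=> 1)) = 1.
Proof.
move=> b1 m0; rewrite /Eh; under eq_integral do rewrite mul1r.
by rewrite integral_hdens.
Qed.

(** [entropy_le_fisher] is applied to g = (phi^2 + e) / P with P = E[phi^2] + e, which is positive,
    bounded and of mean one; the result is then multiplied by P. *)
Lemma regularized_entropy (phi dphi : R -> R) (M e : R) :
  1 < beta -> 0 < m -> 1 < alpha -> alpha <= 3 / 2 -> alpha < beta -> 0 < e ->
  (forall x, 0 < x -> is_derive x 1 phi (dphi x)) ->
  (forall x, 0 < x -> {for x, continuous dphi}) ->
  (forall x, 0 < x -> `|phi x| <= M) ->
  has_mean (fun x => phi x ^+ 2 * ln (phi x ^+ 2)) ->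
  has_mean (fun x => x `^ (2 * alpha) * dphi x ^+ 2) ->
  fine (Eh beta m (fun x => phi x ^+ 2 * ln (phi x ^+ 2))) + e * ln e
  - (fine (Eh beta m (fun x => phi x ^+ 2)) + e)
    * ln (fine (Eh beta m (fun x => phi x ^+ 2)) + e) <=
  2 / rho beta alpha m * fine (Eh beta m (fun x => x `^ (2 * alpha) * dphi x ^+ 2)).
Proof.
move=> b1 m0 a1 a32 ab e0 dphix cdphi phiM intK intA.
set K := fine _; set N := fine _; set A := fine _.
have rho0 := rho_gt0 m0 a1 ab.
have h0 x : 0 < x -> 0 < h x by exact: hdens_gt0.
have cphi x : 0 < x -> {for x, continuous phi}.
  by move=> /dphix; exact: is_derive1_continuous.
have ch x : 0 < x -> {for x, continuous h} by exact: hdens_continuous.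
have phi2M x : 0 < x -> phi x ^+ 2 <= M ^+ 2.
  move=> x0; rewrite -real_normK ?num_real// ler_pXn2r ?nnegrE ?phiM//.
  exact: le_trans (phiM _ x0).
have intN : has_mean (fun x => phi x ^+ 2).
  apply: (@integrable_bounded_hdens _ _ _ _ (M ^+ 2)) => //.
    by apply: measurable_fun_posR => x x0; apply: cvgM; exact: cphi.
  by move=> x x0; rewrite ger0_norm ?sqr_ge0// phi2M.
have int1 := has_mean_cst 1 b1 m0.
have N0 : 0 <= N.
  apply: fine_ge0; apply: integral_ge0 => x /posRE x0; rewrite lee_fin.
  by rewrite mulr_ge0 ?sqr_ge0// ltW// h0.
pose P := N + e.
have P0 : 0 < P by rewrite ltr_wpDl.
pose s x := phi x ^+ 2 + e.
have s0 x : 0 < s x by rewrite ltr_wpDl ?sqr_ge0.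
pose g x := P^-1 * s x.
pose dg x := P^-1 * (2 * (phi x * dphi x)).
have dgx x : 0 < x -> is_derive x 1 g (dg x).
  move=> x0; have dp := dphix _ x0.
  have := is_derive1Z P^-1 (is_derive1D (is_derive1M dp dp) (is_derive_cst e x 1)).
  by move=> /is_derive_eq; apply; rewrite /dg addr0; ring.
have cdg x : 0 < x -> {for x, continuous dg}.
  move=> x0; apply: cvgM; first exact: cvg_cst.
  apply: cvgM; first exact: cvg_cst.
  by apply: cvgM; [exact: cphi|exact: cdphi].
have g0 x : 0 < g x by rewrite mulr_gt0 ?invr_gt0.
have gM x : 0 < x -> 0 < g x <= P^-1 * (M ^+ 2 + e).
  by move=> x0; rewrite g0/= ler_pM2l ?invr_gt0// lerD2r phi2M.
have g1 : fine (Eh beta m g) = 1.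
  rewrite (_ : g = (fun x => P^-1 * phi x ^+ 2 + (P^-1 * e) * 1)); last first.
    by apply/funext => x; rewrite /g /s mulrDr mulr1.
  by rewrite mean_lin// mean1// mulr1 -mulrDr mulVf// gt_eqF.
have x2a x : 0 <= x `^ (2 * alpha) * dphi x ^+ 2 by rewrite mulr_ge0 ?powR_ge0 ?sqr_ge0.
pose J x := x `^ (2 * alpha) * dg x ^+ 2 / g x.
have J0 x : 0 <= J x by apply: divr_ge0; [rewrite mulr_ge0 ?powR_ge0 ?sqr_ge0|exact: ltW].
(* The quotient phi^2 / (phi^2 + e) is at most 1. The summand [0 * 1] puts the bound in the form
   required by [has_mean_lin] and [mean_lin]. *)
have JE x : J x <= 4 / P * (x `^ (2 * alpha) * dphi x ^+ 2) + 0 * 1.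
  rewrite (_ : J x = 4 / P * (x `^ (2 * alpha) * dphi x ^+ 2) * (phi x ^+ 2 / s x)).
    rewrite mul0r addr0; apply: ler_piMr.
      by apply: mulr_ge0 => //; rewrite divr_ge0// ltW.
    by rewrite ler_pdivrMr// mul1r /s lerDl ltW.
  by rewrite /J /dg /g; field; rewrite !gt_eqF.
have intJ : has_mean J.
  apply: (@le_integrable _ _ _ mu _ _ _
    (fun x => ((4 / P * (x `^ (2 * alpha) * dphi x ^+ 2) + 0 * 1) * h x)%:E)).
  - exact: measurable_posR.
  - apply/measurable_EFinP; apply: measurable_fun_posR => x x0.
    apply: cvgM; last exact: ch.
    apply: cvgM.
      apply: cvgM; first exact: (is_derive1_continuous (is_derive1_powR (2 * alpha) x0)).
      by apply: cvgM; exact: cdg.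
    by apply: cvgV; [rewrite gt_eqF|exact: is_derive1_continuous (dgx _ x0)].
  - move=> x /posRE x0; rewrite !abse_EFin lee_fin !(normrM _ (h x)).
    by rewrite ler_wpM2r// !ger0_norm// (le_trans (J0 _) (JE _)).
  - exact: has_mean_lin.
have JA : fine (Eh beta m J) <= 4 / P * A.
  have := le_mean b1 m0 intJ (has_mean_lin (4 / P) 0 intA int1) (fun x _ => JE x).
  by rewrite mean_lin// mul0r addr0.
have intglng : has_mean (fun x => g x * ln (g x)).
  apply: (@integrable_bounded_hdens _ _ _ _ (1 + (P^-1 * (M ^+ 2 + e)) ^+ 2)) => //.
    apply: measurable_fun_posR => x x0.
    have dl := is_derive1_comp (is_derive1_ln (g0 x)) (dgx _ x0).
    exact: is_derive1_continuous (is_derive1M (dgx _ x0) dl).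
  by move=> x x0; exact: xlnx_bounded (gM _ x0).
(* Expand ln g = ln (phi^2 + e) - ln P, bound (phi^2 + e) ln (phi^2 + e) below by [xlnx_shift], and
   take means. *)
have KE : P^-1 * (K + e * ln e - P * ln P) <= fine (Eh beta m (fun x => g x * ln (g x))).
  have int2 := has_mean_lin (- ln P) (e * ln e - e * ln P) intN int1.
  have := le_mean b1 m0 (has_mean_lin P^-1 P^-1 intK int2) intglng.
  rewrite !mean_lin// mean1// -/K -/N.
  rewrite (_ : P^-1 * K + _ = P^-1 * (K + e * ln e - P * ln P)); last by rewrite /P; ring.
  apply=> x x0; rewrite -mulrDr /g -mulrA ler_pM2l ?invr_gt0//.
  rewrite [ln (P^-1 * s x)]lnM ?posrE ?invr_gt0// lnV ?posrE//.
  by have := xlnx_shift (sqr_ge0 (phi x)) e0; rewrite -/(s x) /s; lra.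
have rhc z : 0 < z -> rho beta alpha m <= curvature beta alpha m z.
  by move=> z0; exact: rho_le_curvature.
have := entropy_le_fisher b1 m0 a1 rho0 rhc dgx cdg gM g1 intJ.
move=> /(le_trans KE) H.
have r0 : 0 < (2 * rho beta alpha m)^-1 by rewrite invr_gt0 mulr_gt0.
have {}H := le_trans H (ler_wpM2l (ltW r0) JA).
move: H; rewrite ler_pdivrMl// => /le_trans; apply.
rewrite le_eqVlt; apply/orP; left; apply/eqP.
by field; rewrite !gt_eqF.
Qed.

End regularization.

(** * The logarithmic Sobolev inequality for bounded smooth functions *)

Unset Implicit Arguments.

Theorem theorem3p2 (R : realType) (beta m alpha : R) (phi : R -> R) :
  1 < beta -> 0 < m -> 1 < alpha -> alpha <= 3 / 2 -> alpha < beta ->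
  bounded_pos phi -> smooth_pos phi -> finite_entropy beta m phi ->
  (Enth beta m (fun x => (phi x ^+ 2)%R)
   <= (2 / rho beta alpha m)%:E
      * Eh beta m (fun x => (x `^ (2 * alpha) * (derive1 phi x) ^+ 2)%R))%E.
Proof.
move=> b1 m0 a1 a32 ab [M phiM] sphi fin_ent.
have rho0 := rho_gt0 m0 a1 ab.
have dphi (x : R) : 0 < x -> is_derive x 1 phi (derive1 phi x).
  by move=> x0; apply: DeriveDef; [exact: (sphi 0%N)|rewrite derive1E].
have cdphi (x : R) : 0 < x -> {for x, continuous (derive1 phi)}.
  by move=> x0; apply/differentiable_continuous/derivable1_diffP; exact: (sphi 1%N).
have cphi (x : R) : 0 < x -> {for x, continuous phi}.
  by move=> /dphi; exact: is_derive1_continuous.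
have h0 x : 0 < x -> 0 < hdens beta m x by exact: hdens_gt0.
have A0 x : 0 < x -> 0 <= x `^ (2 * alpha) * derive1 phi x ^+ 2 * hdens beta m x.
  by move=> /h0/ltW; apply: mulr_ge0; rewrite mulr_ge0 ?powR_ge0 ?sqr_ge0.
have mA : measurable_fun (@posR R)
    (fun x => (x `^ (2 * alpha) * derive1 phi x ^+ 2 * hdens beta m x)%:E).
  apply/measurable_EFinP; apply: measurable_fun_posR => x x0.
  apply: cvgM; last exact: hdens_continuous.
  apply: cvgM; first exact: (is_derive1_continuous (is_derive1_powR (2 * alpha) x0)).
  by apply: cvgM; exact: cdphi.
rewrite /Enth /Eh.
set A := (X in (_ <= _ * X)%E).
have A_ge0 : (0 <= A)%E.
  by apply: integral_ge0 => x /posRE x0; rewrite lee_fin A0.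
(* If the Dirichlet form is infinite, so is the right-hand side, since 2 / rho is positive.
   Otherwise all integrals are finite and the inequality is one between reals. *)
have [Aoo|Afin] := eqVneq A +oo%E.
  by rewrite Aoo gt0_muley ?leey// lte_fin divr_gt0.
have intA : (@lebesgue_measure R).-integrable (@posR R)
    (fun x => (x `^ (2 * alpha) * derive1 phi x ^+ 2 * hdens beta m x)%:E).
  apply/integrableP; split => //.
  rewrite [ltLHS](_ : _ = A) ?ltey//; apply: eq_integral => x /set_mem/posRE x0.
  by rewrite abse_EFin ger0_norm// A0.
have intN : (@lebesgue_measure R).-integrable (@posR R)
    (fun x => (phi x ^+ 2 * hdens beta m x)%:E).
  apply: (@integrable_bounded_hdens _ _ _ _ (M ^+ 2)) => //.
    by apply: measurable_fun_posR => x x0; apply: cvgM; exact: cphi.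
  by move=> x x0; rewrite normrX ler_pXn2r ?nnegrE ?phiM//; exact: le_trans (phiM _ x0).
have fA := integral_posR_fin_num intA.
have fN := integral_posR_fin_num intN.
have fK := integral_posR_fin_num fin_ent.
rewrite -[A](fineK fA) -(fineK fN) -(fineK fK) -!EFinM -EFinB lee_fin /=.
rewrite -/(Eh beta m (fun x => phi x ^+ 2)).
(* It remains to prove the inequality for phi^2 + e with 0 < e < 1. *)
apply: regularized_xlnx_limit.
  apply: fine_ge0; apply: integral_ge0 => x /posRE x0; rewrite lee_fin.
  by rewrite mulr_ge0 ?sqr_ge0// ltW// h0.
move=> e /andP[e0 _].
exact: (regularized_entropy b1 m0 a1 a32 ab e0 dphi cdphi phiM fin_ent intA).
Qed.
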